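(* Let $n\ge1$, let $H\in\mathbb{R}^{n\times n}$ be symmetric positive definite, let $\delta>0$, and let $$C_{\delta,H}=\left\{(t,z)\in\mathbb{R}\times\mathbb{R}^n: t\ge\sqrt{\delta^2+z^{\mathsf T}Hz}\right\}.$$ For $a\in\mathbb{R}$ and $b\in\mathbb{R}^n$ set $\beta=\sqrt{b^{\mathsf T}H^{-1}b}$ and consider the problem $$(P_{a,b}^{\delta,H})\qquad\inf_{(t,z)\in C_{\delta,H}}\bigl(at+b^{\mathsf T}z\bigr),$$ with value $\operatorname{val}(P_{a,b}^{\delta,H})$. The recession cone is $$C_{\delta,H}^\infty=\{(s,w): s\ge\sqrt{w^{\mathsf T}Hw}\},$$ and the objective $(t,z)\mapsto at+b^{\mathsf T}z$ is copositive on $C_{\delta,H}^\infty$ if and only if $a\ge\beta$. Moreover: (i) If $a<\beta$, then $\operatorname{val}(P_{a,b}^{\delta,H})=-\infty$. (ii) If $a>\beta$ and $\Delta=\sqrt{a^2-\beta^2}$, then the unique minimizer is $$t^*=\frac{\delta a}{\Delta},\qquad z^*=-\frac{\delta}{\Delta}H^{-1}b,$$ and $\operatorname{val}(P_{a,b}^{\delta,H})=\delta\Delta$. (iii) If $a=\beta>0$, then the value is zero and is not attained. (iv) If $(a,b)=(0,0)$, every feasible point is optimal.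
   Context: For a nonempty closed convex set $C$, the recession cone is $C^\infty=\{d: x+\lambda d\in C\ \forall x\in C,\ \forall\lambda\ge0\}$. A linear functional $c$ is copositive on $C^\infty$ if $c(d)\ge0$ for all $d\in C^\infty$. *)

(* Defs.v *)
From HB Require Import structures.
From mathcomp Require Import all_boot all_order all_algebra.
From mathcomp Require Import boolp classical_sets reals ereal.

Set Implicit Arguments.
Unset Strict Implicit.
Unset Printing Implicit Defensive.

Import Order.TTheory GRing.Theory Num.Theory.
Local Open Scope classical_set_scope.
Local Open Scope ring_scope.

Definition recession_cone (R : realType) (V : lmodType R) (C : set V) : set V :=
  [set d | forall x, C x -> forall l : R, 0 <= l -> C (x + l *: d)].

Definition copositive (R : realType) (V : lmodType R)
    (c : {scalar V}) (K : set V) : Prop :=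
  forall d, K d -> 0 <= c d.

Definition inf_value (R : realType) (V : Type) (C : set V) (f : V -> R) :
  \bar R := ereal_inf [set (f x)%:E | x in C].

Definition minimizers (R : realType) (V : Type) (C : set V) (f : V -> R) :
  set V := [set x | C x /\ forall y, C y -> f x <= f y].

Definition attained (R : realType) (V : Type) (C : set V) (f : V -> R) : Prop :=
  exists2 x, C x & (f x)%:E = inf_value C f.

Definition qform (R : realType) (n : nat) (A : 'M[R]_n) (x : 'cV[R]_n) : R :=
  (x^T *m A *m x) 0 0.

Definition sympd (R : realType) (n : nat) (A : 'M[R]_n) : Prop :=
  A^T = A /\ forall x : 'cV[R]_n, x != 0 -> 0 < qform A x.

(* R x R^n; the regular module R^o makes the product an lmodType R. *)
Definition RxRn (R : realType) (n : nat) : lmodType R :=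
  (R^o * 'cV[R]_n)%type.

Definition Cdelta (R : realType) (n : nat) (delta : R) (H : 'M[R]_n) :
  set (RxRn R n) :=
  [set p | Num.sqrt (delta ^+ 2 + qform H p.2) <= p.1].

Definition objective (R : realType) (n : nat) (a : R) (b : 'cV[R]_n)
  (p : RxRn R n) : R := a * p.1 + (b^T *m p.2) 0 0.

Lemma objective_is_scalar (R : realType) (n : nat) (a : R) (b : 'cV[R]_n) :
  scalar (objective a b).
Proof.
move=> l p q; rewrite /objective /= mulmxDr -scalemxAr !mxE.
by rewrite !mulrDr addrACA; congr (_ + _ + _); rewrite mulrCA.
Qed.

HB.instance Definition _ (R : realType) (n : nat) (a : R) (b : 'cV[R]_n) :=
  GRing.isLinear.Build R (RxRn R n) R *%R (objective a b)
    (objective_is_scalar a b).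

(* Main.v *)
Require Import Defs.
From mathcomp Require Import all_boot all_order all_algebra.
From mathcomp Require Import boolp classical_sets reals ereal.
From mathcomp Require Import ring lra.

Set Implicit Arguments.
Unset Strict Implicit.
Unset Printing Implicit Defensive.

Import Order.TTheory GRing.Theory Num.Theory.
Local Open Scope classical_set_scope.
Local Open Scope ring_scope.

(** Everything is expressed through the inner product <x, y> = x^T H y, for
    which b^T z = <u, z> with u = H^{-1} b and beta = |u|, and Cauchy-Schwarz.
    The vector (1, - u / beta) is a recession direction along which the
    objective has slope a - beta.  For a > beta, the lower bound is
    (Delta^2 + beta^2) (delta^2 + |z|^2) >= (delta Delta + beta |z|)^2, and two
    minimizers differ by some (s, w) with |w| <= |s| and a s = - <u, w>, so that
    (a^2 - beta^2) s^2 <= 0.  For a = beta > 0 the points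
    (l beta + e / beta, - l u) with l = delta^2 / (2 e) have value e. *)

(** [bform A x x] is convertible to [qform A x], which lets the proofs pass freely between the inner
    product and its squared norm. *)
Definition bform (R : realType) (n : nat) (A : 'M[R]_n) (x y : 'cV[R]_n) : R :=
  (x^T *m A *m y) 0 0.

(** * Bounds on an infimum value *)

Lemma inf_value_le (R : realType) (V : Type) (C : set V) (f : V -> R) x :
  C x -> (inf_value C f <= (f x)%:E)%E.
Proof. by move=> Cx; apply: ge_ereal_inf; exists (f x)%:E => //; exists x. Qed.

Lemma inf_value_ge (R : realType) (V : Type) (C : set V) (f : V -> R) m :
  (forall x, C x -> m <= f x) -> (m%:E <= inf_value C f)%E.
Proof. by move=> h; apply/ereal_infP => _ [x Cx <-]; rewrite lee_fin h. Qed.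

(** * The inner product of H and Cauchy-Schwarz *)

Section InnerProduct.
Context (R : realType) (n : nat) (H : 'M[R]_n).
Hypothesis hH : sympd H.
Implicit Types (x y z : 'cV[R]_n) (l : R).

Let q := qform H.
Let B := bform H.

Lemma bformC x y : B x y = B y x.
Proof.
case: hH => sH _; rewrite /B /bform.
rewrite -[in LHS](trmxK (x^T *m H *m y)) mxE.
by rewrite !trmx_mul trmxK sH mulmxA.
Qed.

Lemma bformDr x y z : B x (y + z) = B x y + B x z.
Proof. by rewrite /B /bform mulmxDr mxE. Qed.

Lemma bformZr x l y : B x (l *: y) = l * B x y.
Proof. by rewrite /B /bform -scalemxAr mxE. Qed.

Lemma qformDZ x l y : q (x + l *: y) = q x + 2 * l * B x y + l ^+ 2 * q y.
Proof.
rewrite (_ : q (x + l *: y) = B (x + l *: y) (x + l *: y)) //.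
rewrite bformDr bformZr bformC bformDr bformZr (bformC (x + _)) bformDr bformZr.
rewrite (bformC y x) -[B x x]/(q x) -[B y y]/(q y); ring.
Qed.

Lemma qform0 : q 0 = 0.
Proof. by rewrite /q /qform mulmx0 mxE. Qed.

Lemma qformZ l x : q (l *: x) = l ^+ 2 * q x.
Proof.
rewrite (_ : q (l *: x) = B (l *: x) (l *: x)) //.
by rewrite bformZr bformC bformZr mulrA.
Qed.

Lemma qform_ge0 x : 0 <= q x.
Proof.
have [->|x0] := eqVneq x 0; first by rewrite qform0.
by apply/ltW; case: hH => _; apply.
Qed.

Lemma qform_le0 x : q x <= 0 -> x = 0.
Proof.
move=> qx; apply/eqP/negPn/negP => x0.
by case: hH => _ /(_ x x0); rewrite -/(q x) ltNge qx.
Qed.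

Lemma bform_sqr_le x y : B x y ^+ 2 <= q x * q y.
Proof.
have [->|y0] := eqVneq y 0.
  by rewrite qform0 mulr0 -(scale0r 0) bformZr mul0r expr0n.
have qy : 0 < q y by case: hH => _; apply.
(* The scalar removes from x its projection onto y; the squared norm of the remainder is the Gram
   determinant divided by [q y]. *)
have := qform_ge0 (x + (- (B x y / q y)) *: y); rewrite qformDZ.
rewrite (_ : _ + _ = (q x * q y - B x y ^+ 2) / q y); last first.
  by field; rewrite gt_eqF.
by rewrite pmulr_lge0 ?invr_gt0// subr_ge0.
Qed.

Lemma norm_bform_le x y : `|B x y| <= Num.sqrt (q x) * Num.sqrt (q y).
Proof.
by rewrite -sqrtrM ?qform_ge0// -sqrtr_sqr ler_wsqrtr// bform_sqr_le.
Qed.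

(** A nonzero kernel vector would have squared norm zero. *)
Lemma sympd_unitmx : H \in unitmx.
Proof.
rewrite unitmxE unitfE; apply/negP => /det0P[v v0 vH].
case: hH => _ /(_ v^T); rewrite /qform trmxK vH mul0mx mxE ltxx.
by move=> /(_ _)/notF; apply; rewrite -trmx0 (inj_eq trmx_inj).
Qed.

Lemma mulmx_bform b z : (b^T *m z) 0 0 = B (invmx H *m b) z.
Proof.
case: hH => sH _; rewrite /B /bform trmx_mul trmx_inv sH.
by rewrite -(mulmxA b^T) mulVmx ?sympd_unitmx// mulmx1.
Qed.

(** Identifies beta, given through the inverse of H, with the H-norm of u. *)
Lemma qform_invmx b : qform (invmx H) b = q (invmx H *m b).
Proof.
by rewrite -[RHS]/(B _ _) -mulmx_bform mulmxA.
Qed.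

(** * The feasible set and its recession cone *)

Section Hyperboloid.
Variable delta : R.
Hypothesis delta0 : 0 < delta.

(** Trades the square root for polynomial inequalities. *)
Lemma CdeltaP (t : R) z :
  Cdelta delta H ((t, z) : RxRn R n) <-> 0 <= t /\ delta ^+ 2 + q z <= t ^+ 2.
Proof.
rewrite /Cdelta /= -/q; have d0 : 0 <= delta ^+ 2 + q z.
  by rewrite addr_ge0 ?sqr_ge0 ?qform_ge0.
split=> [h|[t0 h]].
  have t0 : 0 <= t := le_trans (sqrtr_ge0 _) h.
  by split=> //; rewrite -(sqr_sqrtr d0) lerXn2r ?nnegrE ?sqrtr_ge0.
by rewrite -(ger0_norm t0) -sqrtr_sqr ler_wsqrtr.
Qed.

Lemma Cdelta_apex : Cdelta delta H ((delta, 0) : RxRn R n).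
Proof. by apply/CdeltaP; rewrite qform0 addr0 ltW. Qed.

(** The strictness comes from [delta] > 0; it is what later rules out attainment when a = beta. *)
Lemma Cdelta_gt (t : R) z :
  Cdelta delta H ((t, z) : RxRn R n) -> Num.sqrt (q z) < t.
Proof.
move=> /CdeltaP[t0 h]; rewrite -(ger0_norm t0) -sqrtr_sqr ltr_sqrt.
  by apply: lt_le_trans h; rewrite ltrDr exprn_gt0.
by apply: lt_le_trans h; rewrite ltr_wpDr ?qform_ge0 ?exprn_gt0.
Qed.

Lemma recession_coneE :
  recession_cone (Cdelta delta H) =
  [set d : RxRn R n | Num.sqrt (qform H d.2) <= d.1].
Proof.
apply/seteqP; split=> -[s w] /= h; last first.
  move=> -[t z] tz l l0; have := Cdelta_gt tz.
  move/CdeltaP: tz => [t0 tz] /ltW Nz.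
  suff: Cdelta delta H ((t + l * s, z + l *: w) : RxRn R n) by [].
  apply/CdeltaP.
  have s0 : 0 <= s := le_trans (sqrtr_ge0 _) h.
  split; first by rewrite addr_ge0 ?mulr_ge0.
  have Bts : B z w <= t * s.
    apply: le_trans (ler_norm _) (le_trans (norm_bform_le _ _) _).
    by rewrite ler_pM ?sqrtr_ge0.
  have qs : q w <= s ^+ 2.
    by rewrite -(sqr_sqrtr (qform_ge0 w)) lerXn2r ?nnegrE ?sqrtr_ge0.
  rewrite qformDZ -subr_ge0.
  (* The slack splits into the slack of (t, z), a cross term controlled by Cauchy-Schwarz, and the
     slack of the direction (s, w). *)
  have -> : (t + l * s) ^+ 2
      - (delta ^+ 2 + (q z + 2 * l * B z w + l ^+ 2 * q w)) =
    (t ^+ 2 - (delta ^+ 2 + q z)) + 2 * l * (t * s - B z w)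
      + l ^+ 2 * (s ^+ 2 - q w) :> R by ring.
  apply: addr_ge0; last by rewrite mulr_ge0 ?sqr_ge0// subr_ge0.
  by apply: addr_ge0; rewrite ?mulr_ge0// subr_ge0.
(* If s < |w|, start at the apex (delta, 0): feasibility after a step l forces l (|w| - s) < delta,
   and the chosen l makes the left side 2 delta. *)
rewrite leNgt; apply/negP => sw.
have k0 : 0 < Num.sqrt (q w) - s by rewrite subr_gt0.
have l0 : 0 < 2 * delta / (Num.sqrt (q w) - s) by rewrite divr_gt0 ?mulr_gt0.
set l := _ / _ in l0.
have hl : Cdelta delta H ((delta + l * s, 0 + l *: w) : RxRn R n).
  exact: (h _ Cdelta_apex l (ltW l0)).
have := Cdelta_gt hl.
rewrite add0r qformZ sqrtrM ?sqr_ge0// sqrtr_sqr gtr0_norm//.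
rewrite -ltrBlDr -mulrBr.
by rewrite /l divfK ?gt_eqF//; move: delta0; lra.
Qed.

(** * Copositivity and unboundedness of the objective *)

Section Objective.
Variables (a : R) (b : 'cV[R]_n).

Let u := invmx H *m b.
Let beta : R := Num.sqrt (q u).
Let C : set (RxRn R n) := Cdelta delta H.
Let f : RxRn R n -> R := objective a b.

Lemma objectiveE (t : R) z : f (t, z) = a * t + B u z.
Proof. by rewrite /f /objective mulmx_bform. Qed.

Lemma beta_ge0 : 0 <= beta. Proof. exact: sqrtr_ge0. Qed.

Lemma beta_sqr : beta ^+ 2 = q u. Proof. by rewrite sqr_sqrtr ?qform_ge0. Qed.

(* When beta = 0, also u = 0, and the convention 0^-1 = 0 keeps this true. *)
Lemma slope_direction (d := (1, - beta^-1 *: u) : RxRn R n) :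
  recession_cone C d /\ f d = a - beta.
Proof.
rewrite recession_coneE /= objectiveE bformZr -[B u u]/(q u) -beta_sqr mulr1.
rewrite -/q qformZ -beta_sqr -exprMn sqrtr_sqr mulNr normrN.
have [->|b0] := eqVneq beta 0.
  by rewrite mulr0 normr0 expr0n/= mulr0 oppr0; split.
by rewrite mulVf// normr1 mulNr expr2 mulKf.
Qed.

(** Necessity tests the direction of slope a - beta; sufficiency is Cauchy-Schwarz. *)
Lemma objective_copositive :
  (forall d, recession_cone C d -> 0 <= f d) <-> beta <= a.
Proof.
split=> [h|ba [s w]].
  by have [/h + fd] := slope_direction; rewrite fd subr_ge0.
rewrite recession_coneE /= objectiveE => sw.
have := norm_bform_le u w; rewrite -/beta ler_norml => /andP[+ _].
have : beta * Num.sqrt (q w) <= a * s by rewrite ler_pM ?beta_ge0 ?sqrtr_ge0.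
lra.
Qed.

Lemma objective_unbounded : a < beta -> inf_value C f = -oo%E.
Proof.
move=> ab; have [dC fd] := slope_direction; set d := (1, _) in dC fd.
have k0 : 0 < beta - a by rewrite subr_gt0.
have small m : (inf_value C f <= m%:E)%E.
  (* This step length brings the value down from delta a to delta a - |m - delta a|, which is at
     most m. *)
  have l0 : 0 <= `|m - delta * a| / (beta - a) by rewrite divr_ge0// ltW.
  set l := _ / _ in l0.
  apply: le_trans (inf_value_le f (dC _ Cdelta_apex l l0)) _.
  rewrite lee_fin [f _](_ : _ = delta * a + l * (a - beta)).
    rewrite -opprB mulrN divfK ?gt_eqF// lerBlDr -lerBlDl.
    by rewrite -normrN opprB ler_norm.
  rewrite -fd /f addrC objective_is_scalar addrC; congr (_ + _).
  by rewrite /objective /= mulmx0 mxE addr0 mulrC.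
case: (inf_value C f) small => [r||] // small.
  by exfalso; have := small (r - 1); rewrite lee_fin; lra.
by have := small 0.
Qed.

Lemma objective_ge_norm (t : R) z :
  a * t - beta * Num.sqrt (q z) <= f (t, z).
Proof.
rewrite objectiveE lerD2l.
by have := norm_bform_le u z; rewrite -/beta ler_norml => /andP[].
Qed.

Let Delta : R := Num.sqrt (a ^+ 2 - beta ^+ 2).

(** * The case beta < a: value and unique minimizer *)

Section Coercive.
Hypothesis ba : beta < a.

Lemma coercive_gt0 : 0 < a. Proof. exact: le_lt_trans beta_ge0 ba. Qed.

Lemma Delta_sqr : Delta ^+ 2 = a ^+ 2 - beta ^+ 2.
Proof.
by rewrite sqr_sqrtr// subr_ge0 lerXn2r ?nnegrE ?beta_ge0 ?(ltW ba) ?ltW//;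
   exact: coercive_gt0.
Qed.

Lemma Delta_gt0 : 0 < Delta.
Proof.
by rewrite sqrtr_gt0 subr_gt0 ltrXn2r ?nnegrE ?beta_ge0 ?ltW ?coercive_gt0.
Qed.

Lemma objective_ge (p : RxRn R n) : C p -> delta * Delta <= f p.
Proof.
case: p => t z /CdeltaP[t0 tz]; apply: le_trans _ (objective_ge_norm t z).
have D0 := Delta_gt0; have a0 := coercive_gt0; have b0 := beta_ge0.
rewrite lerBrDr.
have Nz := sqrtr_ge0 (q z).
rewrite -(@ler_pXn2r _ 2) ?nnegrE ?addr_ge0 ?mulr_ge0
  ?(ltW delta0) ?(ltW D0) ?(ltW a0)//.
rewrite exprMn (_ : a ^+ 2 = Delta ^+ 2 + beta ^+ 2); last first.
  by rewrite Delta_sqr subrK.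
apply: (@le_trans _ _ ((Delta ^+ 2 + beta ^+ 2) * (delta ^+ 2 + q z)));
  last first.
  by rewrite ler_wpM2l// addr_ge0 ?sqr_ge0.
rewrite -{2}(sqr_sqrtr (qform_ge0 z)); set N := Num.sqrt _.
(* Lagrange's identity: the gap in Cauchy-Schwarz in the plane is a square. *)
rewrite -subr_ge0 (_ : _ - _ = (Delta * N - beta * delta) ^+ 2) ?sqr_ge0//.
ring.
Qed.

(** Equality in the lower bound forces Delta |z| = beta delta with z opposite to u; t is then read
    off the boundary of the hyperboloid. *)
Let tmin : R := delta * a / Delta.
Let zmin : 'cV[R]_n := - (delta / Delta) *: u.

Lemma tmin_sqr : tmin ^+ 2 = delta ^+ 2 + q zmin.
Proof.
rewrite qformZ -beta_sqr (_ : beta ^+ 2 = a ^+ 2 - Delta ^+ 2).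
  by rewrite /tmin; field; rewrite gt_eqF ?Delta_gt0.
by rewrite Delta_sqr; ring.
Qed.

Lemma min_feasible : C ((tmin, zmin) : RxRn R n).
Proof.
apply/CdeltaP; rewrite -tmin_sqr lexx; split=> //.
by rewrite /tmin ?divr_ge0 ?mulr_ge0
  ?(ltW delta0) ?(ltW Delta_gt0) ?(ltW coercive_gt0).
Qed.

Lemma objective_min : f ((tmin, zmin) : RxRn R n) = delta * Delta.
Proof.
rewrite objectiveE bformZr -[B u u]/(q u) -beta_sqr.
rewrite (_ : beta ^+ 2 = a ^+ 2 - Delta ^+ 2); last by rewrite Delta_sqr; ring.
by rewrite /tmin; field; rewrite gt_eqF ?Delta_gt0.
Qed.

Lemma objective_min_unique (p : RxRn R n) :
  C p -> f p = delta * Delta -> p = (tmin, zmin).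
Proof.
case: p => t z /CdeltaP[t0 tz] fp.
have D0 := Delta_gt0.
(* The coefficient -1 puts the difference in the form expanded by [qformDZ]. *)
set s := t - tmin; set w := z + (- 1) *: zmin.
(* As [zmin] is a multiple of u, the value of f at p determines this Lorentz product. *)
have Bts : tmin * t - B z zmin = delta ^+ 2.
  move: fp; rewrite objectiveE bformZr (bformC z) => fp.
  rewrite (_ : B u z = delta * Delta - a * t); last by rewrite -fp; ring.
  by rewrite /tmin; field; rewrite gt_eqF.
(* Expand both squares: the delta^2 from each feasibility relation cancels the 2 delta^2 from the
   Lorentz product. *)
have qws : q w <= s ^+ 2.
  rewrite qformDZ /s; have := tmin_sqr; lra.
have asw : a * s = - B u w.
  move: fp objective_min.
  rewrite !objectiveE bformDr (bformZr u _ zmin) /s; lra.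
have : (a * s) ^+ 2 <= beta ^+ 2 * s ^+ 2.
  rewrite asw sqrrN beta_sqr; apply: le_trans (bform_sqr_le _ _) _.
  by rewrite ler_wpM2l ?qform_ge0.
rewrite exprMn -subr_le0 -mulrBl -Delta_sqr pmulr_rle0 ?exprn_gt0// => s2.
have /eqP : s ^+ 2 = 0 by apply/eqP; rewrite eq_le s2 sqr_ge0.
rewrite sqrf_eq0 subr_eq0 => /eqP ->.
have /qform_le0/eqP := le_trans qws s2.
by rewrite /w scaleN1r subr_eq0 => /eqP ->.
Qed.

Lemma coercive_minimizers : minimizers C f = [set ((tmin, zmin) : RxRn R n)].
Proof.
apply/seteqP; split=> p /= => [[Cp pmin]|->].
  apply: objective_min_unique => //; apply/eqP.
  rewrite eq_le objective_ge// andbT -objective_min pmin//; exact: min_feasible.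
split=> [|y Cy]; first exact: min_feasible.
by rewrite objective_min objective_ge.
Qed.

Lemma coercive_inf_value : inf_value C f = (delta * Delta)%:E.
Proof.
apply/eqP; rewrite eq_le -{1}objective_min inf_value_le ?inf_value_ge//.
  exact: objective_ge.
exact: min_feasible.
Qed.

End Coercive.

(** * The case a = beta > 0: value zero, not attained *)

Section Boundary.
Hypotheses (ab : a = beta) (b0 : 0 < beta).

(** Here the norm bound on f reads beta (t - |z|), and t exceeds |z| strictly. *)
Lemma boundary_gt0 (p : RxRn R n) : C p -> 0 < f p.
Proof.
case: p => t z /Cdelta_gt Nt; apply: lt_le_trans _ (objective_ge_norm t z).
by rewrite ab -mulrBr mulr_gt0// subr_gt0.
Qed.

Lemma boundary_small (e : R) : 0 < e -> exists2 p, C p & f p = e.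
Proof.
(* With this l the cross term 2 l e in t^2 equals delta^2, leaving the slack (e / beta)^2. *)
move=> e0; pose l := delta ^+ 2 / (2 * e).
have l0 : 0 <= l by rewrite divr_ge0 ?sqr_ge0// mulr_ge0// ltW.
exists (l * beta + e / beta, - l *: u).
  apply/CdeltaP; split.
    by apply: addr_ge0; [apply: mulr_ge0|apply: divr_ge0] => //; apply: ltW.
  rewrite qformZ -beta_sqr -subr_ge0 (_ : _ - _ = (e / beta) ^+ 2) ?sqr_ge0//.
  by rewrite /l; field; rewrite !gt_eqF.
rewrite objectiveE bformZr -[B u u]/(q u) -beta_sqr ab.
by field; rewrite gt_eqF.
Qed.

Lemma boundary_inf_value : inf_value C f = 0%:E.
Proof.
apply/eqP; rewrite eq_le inf_value_ge ?andbT.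
  apply/lee_addgt0Pr => e /boundary_small[p Cp <-].
  by rewrite add0e inf_value_le.
by move=> p /boundary_gt0/ltW.
Qed.

Lemma boundary_not_attained : ~ attained C f.
Proof.
move=> [p /boundary_gt0 + fp]; rewrite boundary_inf_value in fp.
by case: fp => ->; rewrite ltxx.
Qed.

End Boundary.

End Objective.
End Hyperboloid.
End InnerProduct.

Theorem theorem7p1 (R : realType) (n : nat) (hn : (1 <= n)%N)
    (H : 'M[R]_n) (hH : sympd H) (delta : R) (hdelta : 0 < delta)
    (a : R) (b : 'cV[R]_n) :
  let beta : R := Num.sqrt (qform (invmx H) b) in
  let C : set (RxRn R n) := Cdelta delta H in
  let f : {scalar RxRn R n} := objective a b in
  let Delta : R := Num.sqrt (a ^+ 2 - beta ^+ 2) in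
  [/\ recession_cone C =
        [set d : RxRn R n | Num.sqrt (qform H d.2) <= d.1],
      copositive f (recession_cone C) <-> beta <= a &
  [/\ (a < beta -> inf_value C f = -oo%E),
      (beta < a ->
        minimizers C f =
          [set ((delta * a / Delta, - (delta / Delta) *: (invmx H *m b))
                 : RxRn R n)]
        /\ inf_value C f = (delta * Delta)%:E),
      (a = beta -> 0 < beta -> inf_value C f = 0%:E /\ ~ attained C f) &
      (a = 0 -> b = 0 -> forall p, C p -> minimizers C f p)]].
Proof.
move=> beta C f Delta.
have betaE : beta = Num.sqrt (qform H (invmx H *m b)).
  by rewrite /beta qform_invmx.
(* Replaces beta throughout by the H-norm of u, the form used in the preceding lemmas. *)
rewrite {}/Delta; clearbody beta; subst beta.
split; first exact: recession_coneE.
  exact: objective_copositive.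
split.
- exact: objective_unbounded.
- by move=> ba; split; [exact: coercive_minimizers|exact: coercive_inf_value].
- move=> ab b0; split; [exact: boundary_inf_value|exact: boundary_not_attained].
- move=> a0 b0 p Cp; split=> // y _.
  have obj0 x : f x = 0.
    rewrite /f [LHS]/(objective a b x) /objective.
    by rewrite a0 b0 trmx0 mul0mx mxE mul0r addr0.
  by rewrite !obj0.
Qed.
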